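(* Let $n$ be a positive integer and let $k$ be an even integer with $n/2+1\le k\le n-1$. Then the graph $H_{n,k}$ is uniquely vector colorable.
   Context: For $x,y\in\mathbb{Z}_2^n$, the weight of $x$ is its number of nonzero coordinates and $d(x,y)$ denotes Hamming distance. $H_{n,k}$ is the graph whose vertices are the even-weight elements of $\mathbb{Z}_2^n$, with $x\sim y$ iff $x+y$ has weight exactly $k$ (addition is bitwise XOR). A vector $t$-coloring of a graph $G$ (with $t\ge 2$) is an assignment $i\mapsto p_i$ of unit vectors in some $\mathbb{R}^d$ to the vertices of $G$ such that $\langle p_i,p_j\rangle\le -1/(t-1)$ whenever $i\sim j$. The vector chromatic number $\chi_v(G)$ is the smallest $t\ge 2$ for which a vector $t$-coloring exists; a vector $\chi_v(G)$-coloring is called optimal. $G$ is uniquely vector colorable (UVC) if any two optimal vector colorings $i\mapsto p_i\in\mathbb{R}^d$ and $i\mapsto q_i\in\mathbb{R}^{d'}$ of $G$ have the same Gram matrix, i.e. $\langle p_i,p_j\rangle=\langle q_i,q_j\rangle$ for all vertices $i,j$. *)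

(* Defs.v *)
From HB Require Import structures.
From mathcomp Require Import all_boot all_order all_algebra.
From mathcomp Require Import reals.
Set Implicit Arguments. Unset Strict Implicit. Unset Printing Implicit Defensive.
Import Order.TTheory GRing.Theory Num.Theory.
Local Open Scope ring_scope.

Definition dotv (R : realType) (d : nat) (p q : 'rV[R]_d) : R :=
  \sum_(i < d) p 0 i * q 0 i.

Definition vec_coloring (R : realType) (T : finType) (adj : rel T) (t : R)
    (d : nat) (p : T -> 'rV[R]_d) : Prop :=
  2 <= t /\
  (forall i, dotv (p i) (p i) = 1) /\
  (forall i j, adj i j -> dotv (p i) (p j) <= - (1 / (t - 1))).

Definition has_vec_coloring (R : realType) (T : finType) (adj : rel T) (t : R) : Prop :=
  exists (d : nat) (p : T -> 'rV[R]_d), vec_coloring adj t p.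

Definition is_vec_chrom (R : realType) (T : finType) (adj : rel T) (t : R) : Prop :=
  has_vec_coloring adj t /\ (forall s : R, has_vec_coloring adj s -> t <= s).

Definition optimal_vec_coloring (R : realType) (T : finType) (adj : rel T)
    (d : nat) (p : T -> 'rV[R]_d) : Prop :=
  exists t : R, is_vec_chrom adj t /\ vec_coloring adj t p.

Definition UVC (R : realType) (T : finType) (adj : rel T) : Prop :=
  forall (d d' : nat) (p : T -> 'rV[R]_d) (q : T -> 'rV[R]_d'),
    optimal_vec_coloring adj p -> optimal_vec_coloring adj q ->
    forall i j, dotv (p i) (p j) = dotv (q i) (q j).

Definition bvec (n : nat) := {ffun 'I_n -> bool}.

Definition wt (n : nat) (x : bvec n) : nat := #|[set i | x i]|.

Definition bxor (n : nat) (x y : bvec n) : bvec n := [ffun i => x i (+) y i].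

Definition Hvert (n : nat) := {x : bvec n | ~~ odd (wt x)}.

Definition Hadj (n k : nat) : rel (Hvert n) :=
  fun x y => wt (bxor (val x) (val y)) == k.
Arguments Hadj : clear implicits.

(* Main.v *)
(** H_{n,k} is a Cayley graph, so its eigenvalues are the Krawtchouk numbers
    K_k(j), taken at the characters chi_a with wt a = j.  The least one is
    K_k(1) = K_k(n-1) = C(n,k) (n-2k)/n, and it is attained only at j = 1, n-1.
    Writing the energy of a coloring (the sum of the inner products over the
    edges) in the Fourier basis and comparing it with the coloring
    x |-> ((-1)^(x_i))_i / sqrt n, every optimal coloring has Fourier
    coefficients only at weights 1 and n-1, that is, q_x = sum_i (-1)^(x_i) v_i
    on even x, and all its edge inner products equal (n-2k)/n.  The
    condition |q_x| = 1 makes the v_i orthogonal (here n > 4, as the hypotheses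
    force), and tightness of the edges makes their norms equal, so the Gram
    matrix is determined.

    The spectral gap: phi(j,k) = K_k(j) / C(n,k) is symmetric in j and k and
    satisfies (n-j) phi(j+1,k) = (n-2k) phi(j,k) - j phi(j-1,k).  The triangle
    inequality in this recurrence gives |phi(j,k)| < (2k-n)/n as long as
    2 <= j <= n-k+1; for n-k+1 < j <= n/2 the same bound follows from
    the recurrence in the other argument, as |phi(j,k)| = |phi(n-k,j)|; and
    phi(n-j,k) = phi(j,k) since k is even. *)
Require Import Defs.
From HB Require Import structures.
From mathcomp Require Import all_boot all_order all_algebra.
From mathcomp Require Import reals.
From mathcomp Require Import zify ring lra.
Import Order.TTheory GRing.Theory Num.Theory.
Set Implicit Arguments. Unset Strict Implicit. Unset Printing Implicit Defensive.
Local Open Scope ring_scope.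

(** * Binary vectors, weights and characters *)

Definition bzero n : bvec n := [ffun=> false].
Definition bones n : bvec n := [ffun=> true].
Definition bunit n (i : 'I_n) : bvec n := [ffun j => j == i].

Definition chi (R : pzRingType) n (a x : bvec n) : R :=
  \prod_(i < n) (-1) ^+ (a i && x i).

Lemma bxorC n (x y : bvec n) : bxor x y = bxor y x.
Proof. by apply/ffunP=> i; rewrite !ffunE addbC. Qed.

Lemma bxorK n (x y : bvec n) : bxor x (bxor x y) = y.
Proof. by apply/ffunP=> i; rewrite !ffunE addKb. Qed.

Lemma bxorxx n (x : bvec n) : bxor x x = bzero n.
Proof. by apply/ffunP=> i; rewrite !ffunE addbb. Qed.

Lemma bxor_eq0 n (x y : bvec n) : (bxor x y == bzero n) = (x == y).
Proof.
apply/eqP/eqP=> [E|->]; apply/ffunP=> i; last by rewrite !ffunE addbb.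
by move/ffunP/(_ i): E; rewrite !ffunE; case: (x i); case: (y i).
Qed.

Lemma wt_sum n (x : bvec n) : wt x = (\sum_i x i)%N.
Proof.
rewrite /wt cardE -sum1_size big_enum -big_mkcond /=.
by apply: eq_bigl => i; rewrite inE.
Qed.

Lemma wt_bzero n : wt (bzero n) = 0%N.
Proof. by rewrite wt_sum big1 // => i; rewrite ffunE. Qed.

Lemma wt_bunit n (i : 'I_n) : wt (bunit i) = 1%N.
Proof. by rewrite /wt (_ : [set _ | _] = [set i]) ?cards1 //; apply/setP=> j;
  rewrite !inE ffunE. Qed.

Lemma wt_max n (x : bvec n) : (wt x <= n)%N.
Proof. by rewrite -[leqRHS]card_ord max_card. Qed.

Lemma wt_bxor_le n (x y : bvec n) : (wt (bxor x y) <= wt x + wt y)%N.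
Proof.
rewrite !wt_sum -big_split; apply: leq_sum => i _; rewrite ffunE.
by case: (x i); case: (y i).
Qed.

Lemma odd_wt_bxor n (x y : bvec n) :
  odd (wt (bxor x y)) = odd (wt x) (+) odd (wt y).
Proof.
rewrite !wt_sum -oddD -big_split /=.
elim/big_ind2: _ => // [a b c d Hab Hcd|i _]; first by rewrite !oddD Hab Hcd.
by rewrite ffunE; case: (x i); case: (y i).
Qed.

Lemma wt_compl n (x : bvec n) : wt (bxor (bones n) x) = (n - wt x)%N.
Proof.
rewrite /wt (_ : [set _ | _] = ~: [set i | x i]); last first.
  by apply/setP=> i; rewrite !inE !ffunE.
by rewrite cardsCs setCK card_ord.
Qed.

Lemma exists_wt n j : (j <= n)%N -> exists x : bvec n, wt x = j.
Proof.
move=> le_jn; exists [ffun i : 'I_n => (i < j)%N].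
rewrite wt_sum -[RHS]card_ord -sum1_card (big_ord_widen n (fun=> 1%N) le_jn).
by rewrite [RHS]big_mkcond /=; apply: eq_bigr => i _; rewrite ffunE;
  case: (i < j)%N.
Qed.

Lemma chiC (R : pzRingType) n (a x : bvec n) : chi R a x = chi R x a.
Proof. by rewrite /chi; apply: eq_bigr => i _; rewrite andbC. Qed.

Lemma chi_bxor (R : comPzRingType) n (a x y : bvec n) :
  chi R a (bxor x y) = chi R a x * chi R a y.
Proof.
rewrite /chi -big_split; apply: eq_bigr => i _.
by rewrite ffunE andb_addr signr_addb.
Qed.

Lemma chi_bzero (R : pzRingType) n (x : bvec n) : chi R (bzero n) x = 1.
Proof. by rewrite /chi big1 // => i _; rewrite ffunE. Qed.

Lemma chi_bones (R : pzRingType) n (x : bvec n) :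
  chi R (bones n) x = (-1) ^+ wt x.
Proof.
rewrite wt_sum /chi; elim/big_ind2: _ => // [a b c d -> ->|i _];
  first by rewrite exprD.
by rewrite ffunE.
Qed.

Lemma chi_bunit (R : comPzRingType) n (i : 'I_n) (x : bvec n) :
  chi R (bunit i) x = (-1) ^+ x i.
Proof.
rewrite /chi (bigD1 i) //= ffunE eqxx big1 ?mulr1 // => j /negPf ji.
by rewrite ffunE ji.
Qed.

(** The sum factors over the coordinates, and a coordinate in the support of [x] contributes the
    factor 1 - 1. *)
Lemma sum_chi (R : comNzRingType) n (x : bvec n) :
  \sum_a chi R a x = if x == bzero n then 2 ^+ n else 0.
Proof.
rewrite /chi -(bigA_distr_bigA (fun i b => (-1) ^+ (b && x i))) /=.
case: eqP => [->|/eqP x0].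
  rewrite (eq_bigr (fun=> 2)) ?prodr_const ?card_ord // => i _.
  by rewrite big_bool /= ffunE expr0.
have /existsP[i xi] : [exists i, x i].
  apply: contraR x0 => /existsPn x0; apply/eqP/ffunP=> i.
  by rewrite ffunE; apply: negbTE; exact: x0.
by rewrite (bigD1 i) //= big_bool /= xi expr1 expr0 addNr mul0r.
Qed.

Lemma chi_orthogonal (R : comNzRingType) n (x y : bvec n) :
  \sum_a chi R a x * chi R a y = if x == y then 2 ^+ n else 0.
Proof.
by rewrite -bxor_eq0 -sum_chi; apply: eq_bigr => a _; rewrite chi_bxor.
Qed.

(** * Krawtchouk numbers as character sums over shells *)

(** The eigenvalue, at the character [a], of the distance-[k] graph on all of Z_2^n. *)
Definition shell_sum (R : pzRingType) n k (a : bvec n) : R :=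
  \sum_(w : bvec n | wt w == k) chi R a w.

(** The generating function of [k |-> K_k(j)]; meaningful only for [j <= n],
    since [n - j] is truncated. *)
Definition kraw_poly (R : nzRingType) n j : {poly R} :=
  (1 - 'X) ^+ j * (1 + 'X) ^+ (n - j).

Definition kraw (R : nzRingType) n k j : R := (kraw_poly R n j)`_k.

Lemma shell_sumE (R : comNzRingType) n k (a : bvec n) :
  shell_sum R k a = kraw R n k (wt a).
Proof.
rewrite /kraw.
(* The right-hand side factors over the coordinates. *)
have -> : kraw_poly R n (wt a) = \sum_(w : bvec n) (chi R a w)%:P * 'X^(wt w).
  transitivity (\prod_(i < n) \sum_(b : bool) (((-1) ^+ (a i && b))%:P * 'X^b :
    {poly R})).
    rewrite (bigID (fun i => a i)) /= /kraw_poly.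
    congr (_ * _).
      rewrite (eq_bigr (fun=> 1 - 'X)) ?prodr_const; last first.
        move=> i ->; rewrite big_bool /= expr1 expr0 expr1 !polyCN mulr1 addrC.
        by rewrite mulN1r.
      by congr (_ ^+ _); rewrite /wt; apply: eq_card => i; rewrite inE.
    rewrite (eq_bigr (fun=> 1 + 'X)) ?prodr_const; last first.
      by move=> i /negPf ->; rewrite big_bool /= expr0 expr1 !mul1r addrC.
    by rewrite -wt_compl; congr (_ ^+ _); rewrite /wt; apply: eq_card => i;
      rewrite inE !ffunE.
  rewrite bigA_distr_bigA; apply: eq_bigr => w _.
  rewrite big_split /= wt_sum /chi rmorph_prod; congr (_ * _).
  by elim/big_ind2: _ => // a1 b1 c1 d1 -> ->; rewrite exprD.
rewrite coef_sum /shell_sum big_mkcond; apply: eq_bigr => w _.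
by rewrite coefCM coefXn eq_sym; case: eqP; rewrite ?mulr1 ?mulr0.
Qed.

(** At [j = 0] the junk index [j.-1] is harmless, its coefficient being [0]. *)
Lemma kraw_rec (R : comNzRingType) n k j : (j < n)%N ->
  (n - j)%:R * kraw R n k j.+1 =
    (n%:R - k%:R *+ 2) * kraw R n k j - j%:R * kraw R n k j.-1.
Proof.
move=> ltjn.
have E : kraw_poly R n j.+1 *+ (n - j) =
    kraw_poly R n j *+ n - ('X * (kraw_poly R n j)^`()) *+ 2
    - kraw_poly R n j.-1 *+ j.
  rewrite /kraw_poly.
  have [m ->] : exists m, n = (j + m.+1)%N by exists (n - j.+1)%N; lia.
  rewrite (_ : j + m.+1 - j = m.+1)%N; last lia.
  rewrite (_ : j + m.+1 - j.+1 = m)%N; last lia.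
  rewrite derivM !deriv_exp.
  rewrite derivB derivD derivX !derivC sub0r add0r mul1r mulN1r.
  case: j {ltjn} => [|j] /=.
    by rewrite !mulr0n expr1 expr0 !exprS; set B := (1 + 'X) ^+ m; ring.
  rewrite (_ : j.+1 + m.+1 - j = m.+2)%N; last lia.
  rewrite !exprS; set B := (1 + 'X) ^+ m; set A := (1 - 'X) ^+ j.
  by ring.
have coefXd (p : {poly R}) : ('X * p^`())`_k = p`_k *+ k.
  by rewrite coefXM; case: k => [|k] //=; rewrite coef_deriv.
move/(congr1 (fun p : {poly R} => p`_k)): E;
  rewrite !(coefB, coefMn) coefXd -/(kraw _ _ _ _).
rewrite -/(kraw R n k j) -/(kraw R n k j.-1) !mulr_natl => ->.
by rewrite /kraw; ring.
Qed.

Lemma sum_shell_sum (R : comNzRingType) n j k : (j <= n)%N ->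
  \sum_(a : bvec n | wt a == j) shell_sum R k a = kraw R n j 0 * kraw R n k j.
Proof.
move=> le_jn; rewrite (eq_bigr (fun=> 1 * kraw R n k j)) => [|a /eqP wa];
  last first.
  by rewrite mul1r shell_sumE wa.
rewrite -mulr_suml -[in RHS](wt_bzero n) -shell_sumE /shell_sum; congr (_ * _).
by apply: eq_bigr => w _; rewrite chi_bzero.
Qed.

(** Double counting of [\sum_a \sum_w chi a w] over [wt a = j], [wt w = k];
    [kraw R n k 0] is the binomial coefficient [C(n,k)]. *)
Lemma kraw_symm (R : comNzRingType) n j k : (j <= n)%N -> (k <= n)%N ->
  kraw R n j 0 * kraw R n k j = kraw R n k 0 * kraw R n j k.
Proof.
move=> le_jn le_kn; rewrite -!sum_shell_sum // /shell_sum exchange_big /=.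
by apply: eq_bigr => w _; apply: eq_bigr => a _; exact: chiC.
Qed.

Lemma kraw0_gt0 (R : numDomainType) n k : (k <= n)%N -> 0 < kraw R n k 0.
Proof.
move=> le_kn; rewrite -(wt_bzero n) -shell_sumE /shell_sum.
rewrite (eq_bigr (fun=> 1)) => [|w _]; last by rewrite chi_bzero.
have [w wk] := exists_wt le_kn.
rewrite (bigD1 w) ?wk //= ltr_pwDl // sumr_ge0 // => *; exact: ler01.
Qed.

Lemma bxor_inj n (x : bvec n) : injective (bxor x).
Proof. exact: can_inj (bxorK x). Qed.

(** Complementing [w] exchanges the shells of weight [k] and [n - k] and multiplies [chi a w] by
    (-1)^(wt a). *)
Lemma kraw_compl (R : comNzRingType) n j k : (j <= n)%N -> (k <= n)%N ->
  kraw R n (n - k) j = (-1) ^+ j * kraw R n k j.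
Proof.
move=> le_jn le_kn; have [a <-] := exists_wt le_jn.
rewrite -!shell_sumE /shell_sum (reindex_inj (@bxor_inj n (bones n))) /=
  mulr_sumr.
apply: eq_big => [w|w _]; last by rewrite chi_bxor chiC chi_bones.
by rewrite wt_compl; have := wt_max w; lia.
Qed.

(** Here [a] is complemented instead, at the cost of the sign (-1)^k. *)
Lemma kraw_sym_even (R : comNzRingType) n j k : (j <= n)%N -> ~~ odd k ->
  kraw R n k (n - j) = kraw R n k j.
Proof.
move=> le_jn ek; have [a <-] := exists_wt le_jn.
rewrite -wt_compl -!shell_sumE; apply: eq_bigr => w /eqP wk.
by rewrite chiC chi_bxor [chi _ w (bones n)]chiC chi_bones wk -signr_odd (negPf
  ek) mul1r chiC.
Qed.

(** * The spectral gap *)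

(** Strong induction with the triangle inequality: two earlier values bounded by [c] give
    (n-a)|f(a+1)| < (|m| + a) c, and |m| + 2a <= n turns the right side into at most (n-a) c. As
    [f 0 = 1] may exceed [c], the value at 2 is treated apart, by means of [1 < c * (n%:R - 1)]. *)
Lemma recurrence_bound (R : realFieldType) (f : nat -> R) (n : nat) (m c : R) :
    f 0%N = 1 ->
    (forall a, (a < n)%N ->
      (n - a)%:R * f a.+1 = m * f a - a%:R * f a.-1) ->
    `|m| <= n%:R - 1 -> `|m| <= n%:R * c -> 1 < c * (n%:R - 1) ->
  forall a, (1 < a)%N -> `|m| + (a.-1 *2)%:R <= n%:R -> `|f a| < c.
Proof.
move=> f0 rec m_le m_lec c_gt.
have n_ge1 : 1 <= n%:R :> R by apply: le_trans (_ : 1 <= `|m| + 1) _;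
  [rewrite lerDr normr_ge0 | lra].
have n_gt0 : (0 < n)%N by rewrite -(ltr0n R); lra.
have n_gt1 : 1 < n%:R :> R.
  rewrite lt_neqAle n_ge1 andbT; apply: contraTneq c_gt => <-.
  by rewrite subrr mulr0 ltr10.
have c_gt0 : 0 < c by rewrite -(pmulr_lgt0 _ (_ : 0 < n%:R - 1)); lra.
have f1 : n%:R * f 1%N = m.
  by have := rec 0%N n_gt0; rewrite subn0 f0 mulr1 mul0r subr0.
have f1_le : `|f 1%N| <= c.
  rewrite -(ler_pM2l (_ : 0 < n%:R)); last lra.
  by rewrite -[X in X * `|_|]ger0_norm ?ler0n // -normrM f1.
have n_gt1' : (1 < n)%N by rewrite -(ltr1n R).
(* Since m f(1) = m^2/n >= 0, the number (n-1) f(2) = m f(1) - 1 lies between -1 and |m| c. *)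
have f2 : `|f 2| < c.
  have := rec 1%N n_gt1'; rewrite /= f0 mulr1 natrB // => E.
  rewrite -(ltr_pM2l (_ : 0 < n%:R - 1)); last lra.
  rewrite -[X in X * `|_|]ger0_norm -?normrM ?E; last lra.
  have mf1 : m * f 1%N = `|m| * `|f 1%N|.
    rewrite -normrM ger0_norm // -f1 -mulrA mulr_ge0 ?ler0n // -expr2 sqr_ge0
      //.
  rewrite mf1 ltr_norml; have := normr_ge0 m; have := normr_ge0 (f 1%N) => ? ?.
  have nf1 : n%:R * `|f 1%N| = `|m| by rewrite -[in RHS]f1 normrM ger0_norm
    ?ler0n.
  apply/andP; split; nra.
move=> a; elim/ltn_ind: a => -[|[|[|a]]] // IH _ le_an.
have nn (b : nat) : `|b%:R| = b%:R :> R by rewrite ger0_norm ?ler0n.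
have m_ge0 := normr_ge0 m.
have lt_an : (a.+2 < n)%N.
  by rewrite -(ltr_nat R); move: le_an; rewrite /= -natr1 natrM -!natr1;
    have := ler0n R a; lra.
have f_a1 : `|f a.+1| <= c.
  case: a IH le_an {lt_an} => // a IH le_an; apply/ltW/IH => //.
  by apply: le_trans le_an; rewrite lerD2l ler_nat; lia.
have f_a2 : `|f a.+2| < c.
  by apply: IH => //; apply: le_trans le_an; rewrite lerD2l ler_nat; lia.
(* When [m = 0] the term in [f a.+2] disappears, so strictness must come from [f a.+1]; for index 1,
   [f 1 = 0]. *)
have f_a1_m0 : m = 0 -> `|f a.+1| < c.
  move=> m0; case: a IH le_an {lt_an f_a1 f_a2} => [|a] IH le_an.
    suff -> : f 1%N = 0 by rewrite normr0.
    by move/eqP: f1; rewrite m0 mulf_eq0 pnatr_eq0 -leqn0 leqNgt n_gt0 => /eqP.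
  by apply: IH => //; apply: le_trans le_an; rewrite lerD2l ler_nat; lia.
have lt_step : `|m| * `|f a.+2| + a.+2%:R * `|f a.+1| < (`|m| + a.+2%:R) * c.
  have a2_gt0 : 0 < a.+2%:R :> R by rewrite ltr0n.
  rewrite [ltRHS]mulrDl; have [m0|m_neq0] := eqVneq m 0.
    by rewrite m0 normr0 !mul0r !add0r ltr_pM2l // f_a1_m0.
  by rewrite ltr_leD ?ltr_pM2l ?ler_pM2l ?normr_gt0.
have na_gt0 : 0 < (n - a.+2)%:R :> R by rewrite ltr0n subn_gt0.
rewrite -(ltr_pM2l na_gt0) -[X in X * `|_|]nn -normrM rec //.
apply: le_lt_trans (ler_normB _ _) _; rewrite !normrM nn.
apply: lt_le_trans lt_step _; rewrite ler_pM2r // natrB; last exact: ltnW.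
by move: le_an; rewrite /= natrM; lra.
Qed.

Lemma kraw_ratio_lt (R : realFieldType) n k j : ~~ odd k ->
  (n + 2 <= 2 * k)%N -> (k <= n - 1)%N -> (1 < j)%N -> (j < n - 1)%N ->
  `|kraw R n k j| * n%:R < (2 * k - n)%:R * kraw R n k 0.
Proof.
move=> ek nk kn; wlog jn : j / (2 * j <= n)%N => [WL|].
  move=> j1 jn1; have [jn|jn] := leqP (2 * j) n; first exact: WL.
  by rewrite -(kraw_sym_even R (_ : (j <= n)%N) ek) //; [apply: WL; lia | lia].
move=> j1 jn1; have n0 : 0 < n%:R :> R by rewrite ltr0n; lia.
have k0 := @kraw0_gt0 R n k ltac:(lia).
set c := (2 * k - n)%:R / n%:R :> R.
have nc : n%:R * c = (2 * k - n)%:R by rewrite /c; field; rewrite gt_eqF.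
(* Because 2k - n >= 2 and n >= 3, (2k-n)(n-1) >= 2(n-1) > n. *)
have c_gt : 1 < c * (n%:R - 1).
  rewrite -(ltr_pM2l n0) mulrA nc mulr1.
  have ge2 : 2 <= (2 * k - n)%:R :> R by rewrite ler_nat; lia.
  have : 3 <= n%:R :> R by rewrite ler_nat; lia.
  by move=> ?; nra.
suff H : `|kraw R n k j / kraw R n k 0| < c.
  move: H; rewrite normrM normfV (gtr0_norm k0) /c ltr_pdivrMr // => H.
  by rewrite -ltr_pdivlMr // mulrAC.
have rec i : (i <= n)%N -> forall a, (a < n)%N ->
    (n - a)%:R * (kraw R n i a.+1 / kraw R n i 0) =
      (n%:R - i%:R *+ 2) * (kraw R n i a / kraw R n i 0) -
      a%:R * (kraw R n i a.-1 / kraw R n i 0).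
  by move=> le_in a lt_an; rewrite mulrA kraw_rec // mulrBl !mulrA.
have ratio1 i : (i <= n)%N -> kraw R n i 0 / kraw R n i 0 = 1.
  by move=> le_in; rewrite divff // gt_eqF // kraw0_gt0.
(* Beyond [j = n - k + 1] the recurrence in [j] is too weak: exchange the roles
   of [j] and [n - k]. *)
have [jk|jk] := leqP j (n - k).+1.
  have m_norm : `|n%:R - k%:R *+ 2| = (2 * k - n)%:R :> R.
    by rewrite -[k%:R *+ 2]mulr_natl -natrM distrC -natrB ?ger0_norm ?ler0n //;
      lia.
  apply: (recurrence_bound (f := fun a => kraw R n k a / kraw R n k 0) (n := n)
    (m := n%:R - k%:R *+ 2)) => //; rewrite ?m_norm ?nc //.
  - by apply: ratio1; lia.
  - by apply: rec; lia.
  - by rewrite -[1]/(1%:R) -natrB ?ler_nat; lia.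
  - by rewrite -natrD ler_nat; lia.
have m_norm : `|n%:R - j%:R *+ 2| = (n - 2 * j)%:R :> R.
  by rewrite -[j%:R *+ 2]mulr_natl -natrM -natrB // ger0_norm.
have -> : `|kraw R n k j / kraw R n k 0| = `|kraw R n j (n - k) / kraw R n j 0|.
  have kn' : (k <= n)%N by lia.
  have jn' : (j <= n)%N by lia.
  have := @kraw_symm R n j (n - k) jn' (leq_subr _ _).
  rewrite !kraw_compl // expr0 mul1r => E.
  have j0 := kraw0_gt0 R jn'.
  have -> : kraw R n j (n - k) = kraw R n j 0 * ((-1) ^+ j * kraw R n k j) /
    kraw R n k 0.
    by rewrite E [X in X / _]mulrC mulfK // gt_eqF.
  by rewrite [in RHS]mulrAC [_ * _ / kraw R n j 0]mulrAC divff ?gt_eqF // mul1r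
    !normrM normr_sign mul1r.
(* [recurrence_bound] starts at index 2; at index 1 a single step of the recurrence gives the exact
   value (n-2j)/n. *)
have [k1|k1] := eqVneq (n - k)%N 1%N.
  have := rec j ltac:(lia) 0%N ltac:(lia).
  rewrite k1 subn0 ratio1 ?mulr1 ?mul0r ?subr0; last lia.
  move=> /(congr1 Num.norm); rewrite m_norm normrM [X in X * _]ger0_norm ?ler0n
    // => E.
  by rewrite -(ltr_pM2l n0) E nc ltr_nat; lia.
apply: (recurrence_bound (f := fun a => kraw R n j a / kraw R n j 0) (n := n)
    (m := n%:R - j%:R *+ 2)) => //; rewrite ?m_norm ?nc //.
- by apply: ratio1; lia.
- by apply: rec; lia.
- by rewrite -[1]/(1%:R) -natrB ?ler_nat; lia.
- by rewrite ler_nat; lia.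
- by lia.
- by rewrite -natrD ler_nat; lia.
Qed.

Lemma kraw1 (R : comNzRingType) n k : (0 < n)%N ->
  n%:R * kraw R n k 1 = (n%:R - k%:R *+ 2) * kraw R n k 0.
Proof. by move=> n0; have := kraw_rec R k n0; rewrite subn0 mul0r subr0. Qed.

(** K_k(1) equals -C(n,k)(2k-n)/n, so the bound on |K_k(j)| suffices for 1 < j < n-1; at j = 0 and j
    = n the value is positive. *)
Lemma kraw1_lt (R : realFieldType) n k j : ~~ odd k ->
  (n + 2 <= 2 * k)%N -> (k <= n - 1)%N -> (j <= n)%N ->
  j != 1%N -> j != (n - 1)%N ->
  kraw R n k 1 < kraw R n k j.
Proof.
move=> ek nk kn; wlog j0 : j / j != n => [WL|] jn j1 jn1.
  have [->|j0] := eqVneq j n; last exact: WL.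
  by rewrite -[kraw R n k n](kraw_sym_even R _ ek) // subnn; apply: WL; lia.
have n0 : 0 < n%:R :> R by rewrite ltr0n; lia.
have k0 := @kraw0_gt0 R n k ltac:(lia).
rewrite -(ltr_pM2l n0) kraw1; last lia.
have -> : n%:R - k%:R *+ 2 = - (2 * k - n)%:R :> R.
  by rewrite natrB ?natrM ?mulr_natl ?opprB //; lia.
have m0 : 0 < (2 * k - n)%:R :> R by rewrite ltr0n; lia.
case: j => [|j] in j0 jn j1 jn1 *; first by have := mulr_gt0 m0 k0;
  have := mulr_gt0 n0 k0; lra.
have := @kraw_ratio_lt R n k j.+1 ek nk kn ltac:(lia) ltac:(lia).
have := ler_norm (- kraw R n k j.+1); rewrite normrN => H1 H2.
by nra.
Qed.

(** * The unnormalised Fourier transform on Z_2^n *)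

Definition fhat (R : pzRingType) n (f : bvec n -> R) (a : bvec n) : R :=
  \sum_x chi R a x * f x.

Lemma fhat_inv (R : comNzRingType) n (f : bvec n -> R) x :
  \sum_a chi R a x * fhat f a = 2 ^+ n * f x.
Proof.
rewrite /fhat; under eq_bigr => a _ do rewrite mulr_sumr.
rewrite exchange_big /= (bigD1 x) //= [X in _ + X]big1 ?addr0 => [|y /negPf yx].
  by under eq_bigr => a _ do rewrite mulrA;
    rewrite -mulr_suml chi_orthogonal eqxx.
by under eq_bigr => a _ do rewrite mulrA;
  rewrite -mulr_suml chi_orthogonal eq_sym yx mul0r.
Qed.

Lemma plancherel (R : comNzRingType) n (f g : bvec n -> R) :
  \sum_a fhat f a * fhat g a = 2 ^+ n * \sum_x f x * g x.
Proof.
rewrite mulr_sumr.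
rewrite [RHS](eq_bigr (fun x => \sum_a (chi R a x * f x) * fhat g a));
  last first.
  move=> x _; rewrite mulrCA -fhat_inv mulr_sumr.
  by apply: eq_bigr => a _; rewrite mulrCA mulrA.
by rewrite exchange_big /=; apply: eq_bigr => a _; rewrite -mulr_suml.
Qed.

(** Characters diagonalise the adjacency operator: substituting x = y + w splits [chi a x] into
    [chi a y * chi a w]. *)
Lemma fhat_neighbours (R : comNzRingType) n k (f : bvec n -> R) a :
  fhat (fun x => \sum_(y | wt (bxor x y) == k) f y) a =
    shell_sum R k a * fhat f a.
Proof.
rewrite /fhat /shell_sum mulr_sumr; under eq_bigr => x _ do rewrite mulr_sumr.
rewrite (exchange_big_dep xpredT) //=; apply: eq_bigr => y _.
rewrite (reindex_inj (@bxor_inj n y)) /= mulr_suml.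
apply: eq_big => [w|w _]; first by rewrite bxorC bxorK.
by rewrite chi_bxor mulrCA mulrA.
Qed.

(** The character at [bones] is 1 on even vectors, so [a] and its complement are indistinguishable
    there. *)
Lemma fhat_compl (R : comNzRingType) n (f : bvec n -> R) a :
  (forall x, odd (wt x) -> f x = 0) -> fhat f (bxor (bones n) a) = fhat f a.
Proof.
move=> f0; apply: eq_bigr => x _; case ox: (odd (wt x));
  first by rewrite f0 ?mulr0.
by rewrite chiC chi_bxor [chi _ x (bones n)]chiC chi_bones -signr_odd ox mul1r
  chiC.
Qed.

(** * The energy argument *)

(** By Plancherel, the total of the left sides minus the right sides is, up to 2^n, a sum of terms
    (K_k(wt a) - K_k(1)) fhat^2 >= 0, while the hypothesis makes it <= 0; so everything vanishes
    termwise. Keeping [dotv (q x) (q x)] in place of 1 admits [q x = 0] at odd [x]. *)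
Lemma spectral_rigidity (R : realType) n k d (q : bvec n -> 'rV[R]_d) :
    ~~ odd k -> (n + 2 <= 2 * k)%N -> (k <= n - 1)%N ->
    (forall x, \sum_(y | wt (bxor x y) == k) dotv (q x) (q y)
       <= kraw R n k 1 * dotv (q x) (q x)) ->
  (forall x, \sum_(y | wt (bxor x y) == k) dotv (q x) (q y)
       = kraw R n k 1 * dotv (q x) (q x)) /\
  (forall c a, wt a != 1%N -> wt a != (n - 1)%N ->
     fhat (fun x => q x 0 c) a = 0).
Proof.
move=> ek nk kn q_le.
set S := fun x => \sum_(y | wt (bxor x y) == k) dotv (q x) (q y).
have kraw_ge (a : bvec n) : kraw R n k 1 <= kraw R n k (wt a).
  have [->|a1] := eqVneq (wt a) 1%N; first by [].
  have [->|a2] := eqVneq (wt a) (n - 1)%N; first by rewrite kraw_sym_even //;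
    lia.
  by apply/ltW/kraw1_lt => //; exact: wt_max.
set F := fun (c : 'I_d) (x : bvec n) => q x 0 c.
have energy :
    \sum_c \sum_a (kraw R n k (wt a) - kraw R n k 1) * fhat (F c) a ^+ 2 =
    2 ^+ n * \sum_x (S x - kraw R n k 1 * dotv (q x) (q x)).
  transitivity (\sum_c (\sum_a fhat (F c) a *
       fhat (fun x => \sum_(y | wt (bxor x y) == k) F c y) a
     - kraw R n k 1 * \sum_a fhat (F c) a * fhat (F c) a)).
    apply: eq_bigr => c _; rewrite mulr_sumr -sumrB; apply: eq_bigr => a _.
    by rewrite fhat_neighbours shell_sumE; ring.
  under eq_bigr => c _ do rewrite !plancherel mulrCA -mulrBr.
  rewrite -mulr_sumr; congr (_ * _); rewrite !sumrB; congr (_ - _).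
    rewrite exchange_big /=; apply: eq_bigr => x _;
      rewrite /S /dotv exchange_big /=.
    by apply: eq_bigr => c _; rewrite mulr_sumr.
  rewrite -!mulr_sumr exchange_big /=; congr (_ * _).
have nonneg c (a : bvec n) :
    0 <= (kraw R n k (wt a) - kraw R n k 1) * fhat (F c) a ^+ 2.
  by rewrite mulr_ge0 ?sqr_ge0 ?subr_ge0.
have energy_ge0 :
    0 <= \sum_c \sum_a (kraw R n k (wt a) - kraw R n k 1) * fhat (F c) a ^+ 2.
  by apply: sumr_ge0 => c _; apply: sumr_ge0 => a _.
have gap_ge0 (x : bvec n) : 0 <= kraw R n k 1 * dotv (q x) (q x) - S x.
  by rewrite subr_ge0; exact: q_le.
have gap0 : \sum_x (kraw R n k 1 * dotv (q x) (q x) - S x) = 0.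
  apply/eqP; rewrite eq_le sumr_ge0 ?andbT; last by move=> x _; exact: gap_ge0.
  move: energy_ge0; rewrite energy pmulr_rge0 ?exprn_gt0 ?ltr0n //.
  by rewrite -oppr_le0 -sumrN; under eq_bigr => x _ do rewrite opprB.
split=> [x|c a a1 a2].
  have /eqP := gap0; rewrite psumr_eq0 => [/allP /(_ x)|y _];
    last exact: gap_ge0.
  by rewrite mem_index_enum subr_eq0 => /(_ isT) /eqP ->.
have /eqP :
    \sum_c \sum_a (kraw R n k (wt a) - kraw R n k 1) * fhat (F c) a ^+ 2 = 0.
  rewrite energy -[X in _ * X]opprK -sumrN.
  by under eq_bigr => x _ do rewrite opprB; rewrite gap0 oppr0 mulr0.
rewrite psumr_eq0 => [/allP /(_ c)|c' _]; last exact: sumr_ge0.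
rewrite mem_index_enum => /(_ isT); rewrite psumr_eq0 // => /allP /(_ a).
rewrite mem_index_enum => /(_ isT); rewrite mulf_eq0 subr_eq0 gt_eqF ?kraw1_lt
  ?wt_max //=.
by rewrite sqrf_eq0 => /eqP.
Qed.

(** * Functions with spectrum at weights 1 and n-1 *)

Lemma wt1P n (a : bvec n) : reflect (exists i, a = bunit i) (wt a == 1%N).
Proof.
apply: (iffP cards1P) => -[i E]; exists i.
  by apply/ffunP=> j; rewrite ffunE -in_set1 -E inE.
by apply/setP=> j; rewrite E !inE ffunE.
Qed.

Lemma bunit_inj n : injective (@bunit n).
Proof. by move=> i j /ffunP /(_ i); rewrite !ffunE eqxx => /esym/eqP. Qed.

Lemma sum_wt1 (V : nmodType) n (F : bvec n -> V) :
  \sum_(a | wt a == 1%N) F a = \sum_i F (bunit i).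
Proof.
transitivity (\sum_(a in [set bunit i | i in 'I_n]) F a).
  apply: eq_bigl => a; apply/wt1P/imsetP => [[i ->]|[i _ ->]]; by exists i.
by rewrite big_imset //= => i j _ _; exact: bunit_inj.
Qed.

(** On even [x] each frequency of weight n-1 repeats its complement of weight 1, whence the factor
    2; [2 < n] keeps the two weights distinct. *)
Lemma spectral_form (R : numFieldType) n (f : bvec n -> R) :
    (2 < n)%N -> (forall x, odd (wt x) -> f x = 0) ->
    (forall a, wt a != 1%N -> wt a != (n - 1)%N -> fhat f a = 0) ->
  forall x, ~~ odd (wt x) ->
  f x = \sum_i chi R (bunit i) x * (2 / 2 ^+ n * fhat f (bunit i)).
Proof.
move=> n2 f_odd f_supp x ex.
have n2_neq0 : 2 ^+ n != 0 :> R by rewrite expf_neq0 // pnatr_eq0.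
apply: (mulfI n2_neq0); rewrite -fhat_inv mulr_sumr.
rewrite (bigID (fun a => wt a == 1%N)) /= sum_wt1.
rewrite [X in _ + X](_ : _ = \sum_(a | wt a == (n - 1)%N)
    chi R a x * fhat f a); last first.
  rewrite big_mkcond [RHS]big_mkcond /=; apply: eq_bigr => a _.
  have [->|a1] := eqVneq (wt a) 1%N; first by case: ifP => //; lia.
  by case: ifPn => // a2; rewrite f_supp ?mulr0.
rewrite (reindex_inj (@bxor_inj n (bones n))) /=.
rewrite [X in _ + X](_ : _ = \sum_(a : bvec n | wt a == 1%N)
    chi R a x * fhat f a); last first.
  apply: eq_big => [a|a _]; first by rewrite wt_compl; have := wt_max a; lia.
  by rewrite fhat_compl // chiC chi_bxor chiC chi_bones -signr_odd (negPf ex)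
    mul1r chiC.
rewrite sum_wt1 -big_split; apply: eq_bigr => i _ /=.
by field.
Qed.

Lemma bunit_pair_eq n (l m i j : 'I_n) : l != m ->
  (bxor (bunit l) (bunit m) == bxor (bunit i) (bunit j)) =
    ((i == l) && (j == m)) || ((i == m) && (j == l)).
Proof.
move=> lm; apply/eqP/idP => [/ffunP E|]; last first.
  by case/orP => /andP[/eqP-> /eqP->] //; rewrite bxorC.
have := E l; have := E m; rewrite !ffunE !eqxx [m == l]eq_sym (negPf lm) /=.
rewrite ![_ == i]eq_sym ![_ == j]eq_sym.
have [->|_] := eqVneq i l; first by rewrite (negPf lm) /= => <-.
have [->|_] := eqVneq j l; last by [].
by rewrite (negPf lm) addbF => <-; rewrite orbT.
Qed.

(** Used with [G] the Gram matrix of the v_i. The entries [G l m] and [G m l] multiply the same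
    character, so symmetry is what separates them. *)
Lemma quadratic_offdiag (R : numFieldType) n (G : 'I_n -> 'I_n -> R) :
    (4 < n)%N -> (forall i j, G i j = G j i) ->
    (forall x, ~~ odd (wt x) ->
      \sum_i \sum_j G i j * (chi R (bunit i) x * chi R (bunit j) x) = 1) ->
  forall l m, l != m -> G l m = 0.
Proof.
move=> n4 Gsym HG l m lm.
set b := bxor (bunit l) (bunit m).
have wt_b : (wt b <= 2)%N by rewrite (leq_trans (wt_bxor_le _ _)) // !wt_bunit.
have b0 : b != bzero n.
  by rewrite bxor_eq0; apply: contra lm => /eqP/bunit_inj->.
have b_ones (u : bvec n) :
    (wt u <= 2)%N -> bxor b (bxor (bones n) u) != bzero n.
  move=> wu; rewrite bxor_eq0; apply/negP=> /eqP E.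
  by have := wt_compl u; rewrite -E; lia.
(* The factor [1 + chi bones x] vanishes on odd [x], and [chi b] extracts the
   coefficient at [b]; as [4 < n], no [bones + e_i + e_j] can equal [b]. *)
have : \sum_x (1 + chi R (bones n) x) * chi R b x *
    (\sum_i \sum_j G i j * (chi R (bunit i) x * chi R (bunit j) x) - 1) = 0.
  rewrite big1 // => x _; case ox : (odd (wt x)).
    by rewrite chi_bones -signr_odd ox expr1 subrr !mul0r.
  by rewrite HG ?ox // subrr mulr0.
have sum_chi' (u : bvec n) :
    \sum_x chi R u x = if u == bzero n then 2 ^+ n else 0.
  by rewrite -sum_chi; apply: eq_bigr => x _; exact: chiC.
pose pair i j := bxor (bunit i) (@bunit n j).
pose T x i j := G i j * (chi R (bxor b (pair i j)) x
  + chi R (bxor b (bxor (bones n) (pair i j))) x).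
have chiDl u v x : chi R (bxor u v) x = chi R u x * chi R v x :> R.
  by rewrite chiC chi_bxor chiC [chi _ x v]chiC.
rewrite (eq_bigr (fun x => \sum_i \sum_j T x i j -
    (chi R b x + chi R (bxor b (bxor (bones n) (bzero n))) x))); last first.
  move=> x _; rewrite mulrBr mulr1 !chiDl chi_bzero; congr (_ - _);
    last by ring.
  rewrite mulr_sumr; apply: eq_bigr => i _; rewrite mulr_sumr;
    apply: eq_bigr => j _.
  by rewrite /T /pair !chiDl; ring.
rewrite sumrB big_split /= !sum_chi' (negPf b0) (negPf (b_ones _ _)) ?wt_bzero
  // addr0 subr0.
rewrite exchange_big /=; under eq_bigr => i _ do rewrite exchange_big /=.
rewrite (eq_bigr (fun i =>
    \sum_j (if ((i == l) && (j == m)) || ((i == m) && (j == l))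
             then G i j * 2 ^+ n else 0))).
  have ml : m != l by rewrite eq_sym.
  rewrite (bigD1 l) //= (bigD1 m) //= !eqxx /= big1 => [|j /negPf jm];
    last first.
    by rewrite jm (negPf lm).
  rewrite addr0 (bigD1 m ml) /= (bigD1 l) //= !eqxx orbT big1 => [|j /negPf
    jl]; last first.
    by rewrite jl (negPf ml).
  rewrite addr0 big1 => [|i /andP[/negPf il /negPf im]]; last first.
    by rewrite big1 // => j _; rewrite il im.
  rewrite addr0 -Gsym -mulr2n => /eqP.
  by rewrite mulrn_eq0 mulf_eq0 expf_eq0 pnatr_eq0 andbF orbF => /eqP.
move=> i _; apply: eq_bigr => j _; rewrite -mulr_sumr big_split /= !sum_chi'.
rewrite (negPf (b_ones _ _)); last by rewrite (leq_trans (wt_bxor_le _ _)) //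
  !wt_bunit.
rewrite addr0 bxor_eq0 bunit_pair_eq //.
by case: ifP => //; rewrite mulr0.
Qed.

Lemma diag_const (R : numDomainType) n k (g : 'I_n -> R) (c : R) :
    (0 < k)%N -> (k < n)%N ->
    (forall w : bvec n, wt w = k -> \sum_i g i * chi R (bunit i) w = c) ->
  forall i j, g i = g j.
Proof.
move=> k0 kn Hg i j; have [->//|ij] := eqVneq i j.
(* Such a set exists because k - 1 <= n - 2. *)
have [A [Aij Ak]] :
    exists A : {set 'I_n}, A \subset ~: [set i; j] /\ #|A| = k.-1.
  have : (0 < #|[set A : {set 'I_n} |
      A \subset ~: [set i; j] & #|A| == k.-1]|)%N.
    rewrite cards_draws bin_gt0; have := cardsC [set i; j].
    rewrite cards2 ij card_ord => E.
    have -> : #|~: [set i; j]| = n.-2 by rewrite -[in RHS]E.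
    by lia.
  by case/card_gt0P => A; rewrite inE => /andP[? /eqP ?]; exists A.
have [iA jA] : i \notin A /\ j \notin A.
  by split; apply/negP => /(subsetP Aij); rewrite !inE eqxx ?orbT.
pose w (l : 'I_n) : bvec n := [ffun x => x \in l |: A].
have wk l : l \notin A -> wt (w l) = k.
  move=> lA; rewrite /wt (_ : [set _ | _] = l |: A) ?cardsU1 ?lA ?Ak ?add1n
    ?prednK //.
  by apply/setP=> x; rewrite inE ffunE.
(* [w i] and [w j] have weight [k] and differ only by swapping [i] and [j]. *)
have : \sum_l g l * (chi R (bunit l) (w j) - chi R (bunit l) (w i)) = 0.
  under eq_bigr => l _ do rewrite mulrBr.
  by rewrite sumrB !Hg ?subrr ?wk.
have ji : j != i by rewrite eq_sym.
rewrite (bigD1 i) //= (bigD1 j ji) /= big1 ?addr0 => [|l /andP[/negPf li /negPf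
  lj]]; last first.
  by rewrite !chi_bunit !ffunE !inE li lj subrr mulr0.
rewrite !chi_bunit !ffunE !inE !eqxx (negPf ij) (negPf ji) (negPf iA) (negPf
  jA) /=.
move=> E; apply/eqP; rewrite -subr_eq0;
  have : (g i - g j) *+ 2 = 0 by rewrite -E; ring.
by move/eqP; rewrite mulrn_eq0.
Qed.

Lemma sum_chi_bunit (R : comPzRingType) n (x : bvec n) :
  \sum_i chi R (bunit i) x = n%:R - (wt x)%:R *+ 2.
Proof.
rewrite wt_sum natr_sum -sumrMnl -[X in X%:R - _]card_ord -sumr_const -sumrB.
by apply: eq_bigr => i _; rewrite chi_bunit; case: (x i);
  rewrite ?expr1 ?expr0 /=; ring.
Qed.

(** * The Gram matrix of a tight coloring *)

Lemma tight_gram (R : realType) n k d (q : bvec n -> 'rV[R]_d) :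
    ~~ odd k -> (n + 2 <= 2 * k)%N -> (k <= n - 1)%N ->
    (forall x, odd (wt x) -> q x = 0) ->
    (forall x, ~~ odd (wt x) -> dotv (q x) (q x) = 1) ->
    (forall x y, ~~ odd (wt x) -> wt (bxor x y) = k ->
       dotv (q x) (q y) <= (n%:R - k%:R *+ 2) / n%:R) ->
  forall x y, ~~ odd (wt x) -> ~~ odd (wt y) ->
    dotv (q x) (q y) = (\sum_i chi R (bunit i) (bxor x y)) / n%:R.
Proof.
move=> ek nk kn q_odd q_even q_adj.
have n_neq0 : n%:R != 0 :> R by rewrite pnatr_eq0; lia.
set c := (n%:R - k%:R *+ 2) / n%:R in q_adj *.
(* The degree times the edge bound [c] is exactly the least eigenvalue, so summing the edge bounds
   yields the hypothesis of [spectral_rigidity]. *)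
have kraw1E : kraw R n k 1 = kraw R n k 0 * c.
  by apply: (mulfI n_neq0); rewrite kraw1; [rewrite /c; field | lia].
have sum_c x : \sum_(y : bvec n | wt (bxor x y) == k) c = kraw R n k 0 * c.
  rewrite -[c in LHS]mul1r -mulr_suml -(wt_bzero n) -shell_sumE; congr (_ * _).
  rewrite (reindex_inj (@bxor_inj n x)) /=; apply: eq_big => [w|w _];
    first by rewrite bxorK.
  by rewrite chi_bzero.
have dot0 x y : odd (wt x) -> dotv (q x) (q y) = 0.
  by move=> ox; rewrite /dotv big1 // => i _; rewrite q_odd // mxE mul0r.
have q_le x : \sum_(y | wt (bxor x y) == k) dotv (q x) (q y)
       <= kraw R n k 1 * dotv (q x) (q x).
  have [ox|ex] := boolP (odd (wt x)).
    by rewrite dot0 // mulr0 big1 // => y _; rewrite dot0.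
  rewrite q_even // mulr1 kraw1E -(sum_c x); apply: ler_sum => y /eqP;
    exact: q_adj.
have [q_eq q_supp] := spectral_rigidity ek nk kn q_le.
(* Each term is at most [c] and their sum is the degree times [c], so each equals [c]. *)
have q_tight x y : ~~ odd (wt x) -> wt (bxor x y) = k -> dotv (q x) (q y) = c.
  move=> ex xy; have := q_eq x; rewrite q_even // mulr1 kraw1E -(sum_c x) =>
    /esym/eqP.
  rewrite -subr_eq0 -sumrB psumr_eq0 => [/allP /(_ y)|z /eqP xz]; last first.
    by rewrite subr_ge0 q_adj.
  by rewrite mem_index_enum xy eqxx subr_eq0 => /(_ isT) /eqP.
(* [v c i] is coordinate [c] of the vector v_i, with the coefficient taken from [spectral_form]. *)
pose v c i := 2 / 2 ^+ n * fhat (fun x => q x 0 c) (bunit i).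
pose G i j := \sum_c v c i * v c j.
have dotE x y : ~~ odd (wt x) -> ~~ odd (wt y) -> dotv (q x) (q y) =
    \sum_i \sum_j G i j * (chi R (bunit i) x * chi R (bunit j) y).
  move=> ex ey; rewrite /dotv.
  transitivity (\sum_c \sum_i \sum_j v c i * v c j * (chi R (bunit i) x * chi R
    (bunit j) y)).
    apply: eq_bigr => e _.
    have qE z : ~~ odd (wt z) -> q z 0 e = \sum_i chi R (bunit i) z * v e i.
      move=> ez; apply: (spectral_form (f := fun z => q z 0 e)) => //;
        first by lia.
        by move=> u ou; rewrite q_odd // mxE.
      exact: q_supp.
    rewrite !qE // mulr_suml; apply: eq_bigr => i _; rewrite mulr_sumr.
    by apply: eq_bigr => j _; ring.
  rewrite exchange_big /=; apply: eq_bigr => i _.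
  by rewrite exchange_big /=; apply: eq_bigr => j _; rewrite -mulr_suml.
have G0 : forall i j, i != j -> G i j = 0.
  apply: quadratic_offdiag; [by lia|by move=> i j; apply: eq_bigr => e _;
    rewrite mulrC|].
  by move=> x ex; rewrite -dotE // q_even.
have dotE' x y : ~~ odd (wt x) -> ~~ odd (wt y) -> dotv (q x) (q y) =
    \sum_i G i i * chi R (bunit i) (bxor x y).
  move=> ex ey; rewrite dotE //; apply: eq_bigr => i _;
    rewrite (bigD1 i) //= big1 => [|j ji].
    by rewrite addr0 chi_bxor.
  by rewrite G0 ?mul0r // eq_sym.
have bxor0 (w : bvec n) : bxor (bzero n) w = w by apply/ffunP=> i;
  rewrite !ffunE.
(* The neighbours of the zero vector are the vectors of weight [k], so tightness there is the
   hypothesis of [diag_const]. *)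
have G_const : forall i j, G i i = G j j.
  apply: (@diag_const R n k (fun i => G i i) c); [by lia|by lia|].
  move=> w wk; rewrite -[w in LHS]bxor0 -dotE' ?wt_bzero ?wk //.
  by rewrite q_tight ?wt_bzero ?bxor0.
have G_diag i : G i i = n%:R^-1.
  apply: (mulfI n_neq0); rewrite divff //.
  have e0 : ~~ odd (wt (bzero n)) by rewrite wt_bzero.
  rewrite -[RHS](q_even _ e0) dotE' // bxor0 (eq_bigr (fun=> G i i)).
    by rewrite sumr_const card_ord mulr_natl.
  by move=> j _; rewrite chiC chi_bzero mulr1 (G_const j i).
move=> x y ex ey; rewrite dotE' // mulr_suml; apply: eq_bigr => i _.
by rewrite G_diag mulrC.
Qed.

(** * The bound on the optimal value, and uniqueness *)

(** This [t] solves -1/(t-1) = (n-2k)/n, the inner product of normalised sign vectors at distance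
    [k]. *)
Lemma canonical_coloring (R : realType) n k :
    (0 < n)%N -> (n + 2 <= 2 * k)%N -> (k <= n - 1)%N ->
  has_vec_coloring (Hadj n k) ((2 * k)%:R / (2 * k - n)%:R : R).
Proof.
move=> n0 nk kn.
exists n, (fun x => \row_i (chi R (bunit i) (val x) / Num.sqrt n%:R)).
have n_gt0 : 0 < n%:R :> R by rewrite ltr0n.
have dotE (x y : bvec n) : dotv (\row_i (chi R (bunit i) x / Num.sqrt n%:R))
    (\row_i (chi R (bunit i) y / Num.sqrt n%:R)) =
    (n%:R - (wt (bxor x y))%:R *+ 2) / n%:R.
  rewrite -sum_chi_bunit mulr_suml; apply: eq_bigr => i _.
  by rewrite !mxE chi_bxor mulrACA -invfM -expr2 sqr_sqrtr // ltW.
have m_gt0 : 0 < (2 * k - n)%:R :> R by rewrite ltr0n; lia.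
have m_eq : (2 * k - n)%:R = 2 * k%:R - n%:R :> R by rewrite natrB ?natrM //;
  lia.
split; last split.
- rewrite ler_pdivlMr // -natrM ler_nat; lia.
- move=> x; rewrite dotE bxorxx wt_bzero mul0rn subr0 divff ?gt_eqF //.
- move=> x y /eqP xy; rewrite dotE xy le_eqVlt; apply/orP; left; apply/eqP.
  rewrite natrM m_eq; field; rewrite -m_eq gt_eqF //=.
  by rewrite m_eq (_ : _ + _ = n%:R) ?gt_eqF //; ring.
Qed.

(** The optimal [t] is at most the canonical value, and -1/(t-1) increases with [t], so edge
    products are at most (n-2k)/n, as [tight_gram] requires. *)
Lemma optimal_gram (R : realType) n k d (p : Hvert n -> 'rV[R]_d) :
    ~~ odd k -> (n + 2 <= 2 * k)%N -> (k <= n - 1)%N ->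
    optimal_vec_coloring (Hadj n k) p ->
  forall x y, dotv (p x) (p y) =
    (\sum_i chi R (bunit i) (bxor (val x) (val y))) / n%:R.
Proof.
move=> ek nk kn [t [[_ t_min] [t2 [p1 p_adj]]]] x y.
have n_gt0 : 0 < n%:R :> R by rewrite ltr0n; lia.
(* Extension by 0: [insub] yields [None] at odd vectors. *)
pose q (z : bvec n) : 'rV[R]_d := oapp p 0 (insub z).
have qE z : q (val z) = p z by rewrite /q valK.
rewrite -!qE; apply: (tight_gram ek nk kn).
- by move=> z oz; rewrite /q insubN // negbK.
- by move=> z ez; rewrite -[z](SubK (Hvert n) ez) qE p1.
- move=> z w ez zw.
  have ew : ~~ odd (wt w) by have := odd_wt_bxor z w;
    rewrite zw (negPf ek) (negPf ez) addFb => <-.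
  rewrite -[z](SubK (Hvert n) ez) -[w](SubK (Hvert n) ew) !qE.
  apply: le_trans (p_adj _ _ _) _; first by rewrite /Hadj !SubK zw.
  have := t_min _ (@canonical_coloring R n k ltac:(lia) nk kn).
  have m_gt0 : 0 < (2 * k - n)%:R :> R by rewrite ltr0n; lia.
  rewrite ler_pdivlMr // => t_le.
  have m_eq : (2 * k - n)%:R = 2 * k%:R - n%:R :> R by rewrite natrB ?natrM //;
    lia.
  have -> : n%:R - k%:R *+ 2 = - (2 * k - n)%:R :> R by rewrite m_eq; ring.
  rewrite mulNr lerN2 div1r ler_pdivrMr // ler_pdivlMl; last lra.
  by rewrite natrM in t_le; lra.
- exact: (valP x).
- exact: (valP y).
Qed.

Theorem theorem3p9 (R : realType) (n k : nat) :
  (0 < n)%N -> ~~ odd k -> (n + 2 <= 2 * k)%N -> (k <= n - 1)%N ->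
  UVC R (Hadj n k).
Proof.
move=> _ ek nk kn d d' p q p_opt q_opt i j.
by rewrite !(optimal_gram ek nk kn).
Qed.
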